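(* The maximum size of a set system $\mathcal{F}\subseteq\binom{[6]}{3}$ with VC-dimension at most $2$ is exactly $13$; that is, every $\mathcal{F}\subseteq\binom{[6]}{3}$ with VC-dimension at most $2$ satisfies $|\mathcal{F}|\le 13$, and there exists such an $\mathcal{F}$ with $|\mathcal{F}|=13$.
   Context: Here $[6]=\{1,\dots,6\}$ and $\binom{[6]}{3}$ denotes the collection of all $3$-element subsets of $[6]$. A set system $\mathcal{F}\subseteq 2^{X}$ shatters $S\subseteq X$ if $\{F\cap S: F\in\mathcal{F}\}=2^{S}$. The VC-dimension of $\mathcal{F}$ is the largest integer $d$ such that some $S\subseteq X$ with $|S|=d$ is shattered by $\mathcal{F}$; ''VC-dimension at most $2$'' means that no $3$-element subset of $[6]$ is shattered by $\mathcal{F}$. *)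

(* Defs.v *)
From mathcomp Require Import all_boot.

Set Implicit Arguments.
Unset Strict Implicit.
Unset Printing Implicit Defensive.

Definition shatters (T : finType) (F : {set {set T}}) (S : {set T}) : bool :=
  [set A :&: S | A in F] == powerset S.

(* The maximum over an empty range is 0, so the empty family, which shatters
   no set at all, gets VC-dimension 0. *)
Definition VCdim (T : finType) (F : {set {set T}}) : nat :=
  \max_(S : {set T} | shatters F S) #|S|.

Definition ksubsets (T : finType) (k : nat) : {set {set T}} :=
  [set A : {set T} | #|A| == k].

(* Main.v *)
Require Import Defs.
From mathcomp Require Import all_boot.

Set Implicit Arguments.
Unset Strict Implicit.
Unset Printing Implicit Defensive.

(** A family of triples shatters no triple iff for every triple [S] some
    [P \subset S] is not a trace, that is, iff the family omits the whole fiber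
    [{A | A :&: S = P}].  A backtracking search over the choice of one such [P]
    for each [S] shows that the omitted triples number at least 7 out of 20.
    To make the search computable, subsets are coded by their characteristic
    bit sequences. *)

Section BitCode.

Variable n : nat.
Implicit Types (A S : {set 'I_n}) (F : {set {set 'I_n}}) (w s : bitseq).

Definition code A : bitseq := [seq i \in A | i <- enum 'I_n].

Definition decode w : {set 'I_n} := [set i : 'I_n | nth false w i].

Definition meet s w : bitseq := [seq p.1 && p.2 | p <- zip s w].

Lemma size_code A : size (code A) = n.
Proof. by rewrite size_map size_enum_ord. Qed.

Lemma codeK : cancel code decode.
Proof.
move=> A; apply/setP=> i; rewrite inE (nth_map i) ?nth_ord_enum //.
by rewrite size_enum_ord.
Qed.

Lemma decodeK w : size w = n -> code (decode w) = w.
Proof.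
move=> wn; rewrite -[RHS](mkseq_nth false) wn /mkseq -val_enum_ord -map_comp.
by apply: eq_map => i; rewrite /= inE.
Qed.

Lemma code_setI A S : code (A :&: S) = meet (code S) (code A).
Proof.
rewrite /meet /code zip_map -map_comp.
by apply: eq_map => i; rewrite /= inE andbC.
Qed.

Lemma count_code A : count id (code A) = #|A|.
Proof. by rewrite count_map cardE size_filter enumT. Qed.

End BitCode.

Fixpoint words n : seq bitseq :=
  if n is m.+1 then map (cons true) (words m) ++ map (cons false) (words m)
  else [:: [::]].

Lemma mem_words n w : (w \in words n) = (size w == n).
Proof.
have cons_inj (b : bool) : injective (cons b) by move=> u v [].
elim: n w => [|n IH] [|b w] //=; rewrite mem_cat.
  by apply/negbTE/norP; split; apply/mapP=> -[].
have cons_neq c d : c != d -> (d :: w \in map (cons c) (words n)) = false.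
  by move/eqP=> cd; apply/mapP=> -[u _ []] /esym.
by case: b; rewrite (mem_map (cons_inj _)) cons_neq ?orbF //= IH.
Qed.

Lemma words_uniq n : uniq (words n).
Proof.
elim: n => [//|n IH] /=; rewrite cat_uniq !map_inj_uniq ?IH ?andbT => [|u v []|u v []] //.
by apply/hasPn=> _ /mapP[u _ ->]; apply/mapP=> -[].
Qed.

Definition subwords (s : bitseq) : seq bitseq :=
  [seq p <- words (size s) | meet s p == p].

Definition shatters_code (L : seq bitseq) (s : bitseq) : bool :=
  all [in map (meet s) L] (subwords s).

(** Every trace on [S] is a subset of [S], so shattering only asks that each [P \subset S] be a
    trace; [meet s p == p] encodes [P :&: S = P]. *)
Lemma shattersE n (F : {set {set 'I_n}}) (S : {set 'I_n}) :
  shatters F S = shatters_code (map (@code n) (enum F)) (code S).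
Proof.
have code_inj := can_inj (@codeK n).
have traceE P : (code P \in map (meet (code S)) (map (@code n) (enum F))) =
                (P \in [set A :&: S | A in F]).
  rewrite -map_comp; apply/mapP/imsetP => -[A AF PE]; exists A.
  - by rewrite mem_enum in AF.
  - by apply: code_inj; rewrite PE code_setI.
  - by rewrite mem_enum.
  - by rewrite PE code_setI.
rewrite /shatters eqEsubset; apply/andP/allP => [[_ /subsetP sub] p | all_tr].
  rewrite mem_filter mem_words size_code => /andP[/eqP pS /eqP pn].
  rewrite -(decodeK pn) traceE; apply/sub; rewrite powersetE; apply/setIidPl.
  by apply: code_inj; rewrite code_setI decodeK.
split; apply/subsetP=> P; first by case/imsetP=> A _ ->; rewrite powersetE subsetIr.
rewrite powersetE -traceE => /setIidPl PS; apply: all_tr.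
by rewrite mem_filter mem_words !size_code -code_setI PS !eqxx.
Qed.

Definition layer n k : seq bitseq := [seq w <- words n | count id w == k].

Lemma mem_layer n k (A : {set 'I_n}) : (code A \in layer n k) = (#|A| == k).
Proof. by rewrite mem_filter mem_words count_code size_code eqxx andbT. Qed.

(** Converts an upper bound on [#|F|] into a lower bound on the number of omitted words, which is
    what the search certifies. *)
Lemma card_code_layer n k (F : {set {set 'I_n}}) (L := map (@code n) (enum F)) :
    F \subset ksubsets 'I_n k ->
  #|F| + size [seq w <- layer n k | w \notin L] = size (layer n k).
Proof.
move=> /subsetP Fk; rewrite -[RHS](count_predC [in L]) -!size_filter; congr addn.
rewrite cardE -(size_map (@code n)); apply/perm_size/uniq_perm.
- by rewrite map_inj_uniq ?enum_uniq //; apply: can_inj (@codeK n).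
- by rewrite !filter_uniq ?words_uniq.
move=> w; rewrite [RHS]mem_filter andb_idr // => /mapP[A].
by rewrite mem_enum => /Fk; rewrite inE -mem_layer => ? ->.
Qed.

Section Search.

Variable D : seq bitseq.

Definition fiber (s p : bitseq) : seq bitseq := [seq w <- D | meet s w == p].

(* [M] collects words that the family must omit so far, [ss] lists the sets
   whose missing trace has not been chosen yet, and [k] is the number of
   omissions to be exceeded.  The cut is an [if] because [||] evaluates both
   of its arguments under [vm_compute]. *)
Fixpoint exceeds (k : nat) (M ss : seq bitseq) : bool :=
  if k < size M then true else
  if ss is s :: r then
    if has (fun p => all [in M] (fiber s p)) (subwords s) then exceeds k M r
    else all (fun p => exceeds k (undup (fiber s p ++ M)) r) (subwords s)
  else false.

(** The invariant is that every word of [M] is omitted by [L]. The true missing trace is unknown,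
    but the search succeeds on all candidates, hence on that one. *)
Lemma exceedsP k M ss L :
    {in ss, forall s, ~~ shatters_code L s} ->
    uniq M -> {subset M <= [seq w <- D | w \notin L]} ->
  exceeds k M ss -> k < size [seq w <- D | w \notin L].
Proof.
elim: ss M => [|s r IH] M nsh uM subM /=.
  by case: ifP => // /leq_trans-> //; apply: uniq_leq_size.
case: ifP => [/leq_trans-> //|_]; first exact: uniq_leq_size.
have {}IH := IH _ (fun t tr => nsh t (mem_behead (s := s :: r) tr)).
(* If a fiber of [s] is already inside [M], skipping [s] is sound: it merely discards a
   constraint. *)
case: ifP => [_|_ /allP branch]; first exact: IH.
have /allPn[p ps missing] := nsh s (mem_head s r).
apply: IH (branch p ps); first exact: undup_uniq.
move=> w; rewrite mem_undup mem_cat => /orP[|/subM //].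
rewrite !mem_filter => /andP[/eqP wp ->]; rewrite andbT.
by apply: contra missing => wL; rewrite -wp map_f.
Qed.

End Search.

Lemma exceeds_layer : exceeds (layer 6 3) 6 [::] (layer 6 3).
Proof. by vm_compute. Qed.

Lemma card_leq13 (F : {set {set 'I_6}}) :
    F \subset ksubsets 'I_6 3 -> (forall S, shatters F S -> #|S| <= 2) ->
  #|F| <= 13.
Proof.
move=> F3 vc; set L := map (@code 6) (enum F).
have nsh : {in layer 6 3, forall s, ~~ shatters_code L s}.
  move=> s sl; have : size s == 6 by move: sl; rewrite mem_filter mem_words => /andP[].
  move/eqP/decodeK=> sK; rewrite -sK -shattersE; apply/negP=> /vc.
  by rewrite -sK mem_layer in sl; rewrite (eqP sl).
have nil_sub : {subset [::] <= [seq w <- layer 6 3 | w \notin L]} by [].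
have big := @exceedsP _ 6 [::] _ L nsh isT nil_sub exceeds_layer.
(* There are 20 triples, and [big] says that at least 7 are omitted. *)
have := card_code_layer F3; rewrite -/L (_ : size (layer 6 3) = 13 + 7) // => total.
by rewrite -(leq_add2r 7) -total leq_add2l.
Qed.

(** Allows the enumeration of a family to be replaced by an explicit list on which the test
    computes. *)
Lemma shatters_code_eq L L' s : L =i L' -> shatters_code L s = shatters_code L' s.
Proof.
by move=> LL'; apply: eq_all => p; apply: eq_mem_map.
Qed.

(** No two of these are complementary, so 14 triples [S] lose the trace [S] or the empty trace. The
    other six, 015, 234, 024, 135, 045 and 123, lose the traces 01, 2, 02, 1, 0 and 12 respectively,
    each with a fiber of three omitted triples. *)
Definition omitted_triples : seq bitseq :=
  [seq mkseq [in c] 6 | c <- [:: [:: 0; 1; 2]; [:: 0; 1; 3]; [:: 0; 1; 4];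
    [:: 0; 2; 3]; [:: 0; 2; 5]; [:: 1; 2; 4]; [:: 1; 2; 5]]].

Definition kept_triples : seq bitseq :=
  [seq w <- layer 6 3 | w \notin omitted_triples].

Lemma kept_triples_VC :
  all (fun s => shatters_code kept_triples s ==> (count id s <= 2)) (words 6).
Proof. by vm_compute. Qed.

Definition kept_family : {set {set 'I_6}} := [set A | code A \in kept_triples].

Lemma codes_kept_family : perm_eq (map (@code 6) (enum kept_family)) kept_triples.
Proof.
apply: uniq_perm; last 1 first.
- move=> w; apply/mapP/idP => [[A] | wk].
    by rewrite mem_enum inE => Ak ->.
  have /decodeK wK : size w = 6.
    by move: wk; rewrite !mem_filter mem_words => /and3P[_ _ /eqP].
  by exists (decode 6 w); rewrite ?mem_enum ?inE wK.
- by rewrite map_inj_uniq ?enum_uniq //; apply: can_inj (@codeK 6).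
- by rewrite !filter_uniq ?words_uniq.
Qed.

Theorem mainTheorem2 :
  (forall F : {set {set 'I_6}},
     F \subset ksubsets 'I_6 3 -> VCdim F <= 2 -> #|F| <= 13) /\
  (exists F : {set {set 'I_6}},
     [/\ F \subset ksubsets 'I_6 3, VCdim F <= 2 & #|F| = 13]).
Proof.
split=> [F F3 /bigmax_leqP | ]; first exact: card_leq13.
exists kept_family; split.
- apply/subsetP=> A; rewrite [A \in kept_family]inE mem_filter => /andP[_].
  by rewrite mem_layer inE.
- apply/bigmax_leqP=> S.
  rewrite shattersE (shatters_code_eq _ (perm_mem codes_kept_family)).
  have /allP/(_ (code S)) := kept_triples_VC.
  by rewrite mem_words size_code count_code => /(_ isT)/implyP.
- by rewrite cardE -(size_map (@code 6)) (perm_size codes_kept_family).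
Qed.
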